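(* Let $\beta=\sup_{z\in\mathcal Z}\|\nabla F(z)-\nabla F_1(z)\|_{\mathrm{op}}$. Run the outer scheme described in the context for $T\ge1$ iterations with surrogate $J_k=\nabla F_1(v_k)$, model level $\delta=\beta$ and dual-step parameter $\rho_k=\beta$. Then $\|\nabla F(v_k)-J_k\|_{\mathrm{op}}\le\beta$ at every iteration $k$, and $$\mathrm{Gap}(\widetilde z_T)\le\frac{16\sqrt2\,L_1D^3}{T^{3/2}}+\frac{16\sqrt2\,\beta D^2}{T}.$$
   Context: Norms are Euclidean; $\|\cdot\|_{\mathrm{op}}$ is the operator norm. $\mathcal Z\subset\mathbb R^d$ is nonempty, compact and convex with diameter $D$. $F=\sum_{i=1}^M w_iF_i$ with $w_i>0$, $\sum_i w_i=1$, all $F_i:\mathcal Z\to\mathbb R^d$ continuously differentiable. $F$ is monotone: $\langle F(x)-F(y),x-y\rangle\ge0$ for all $x,y\in\mathcal Z$; and $\|\nabla F(x)-\nabla F(y)\|_{\mathrm{op}}\le L_1\|x-y\|$ for all $x,y\in\mathcal Z$, $L_1>0$. $\mathrm{Gap}(\widehat z)=\sup_{z\in\mathcal Z}\langle F(z),\widehat z-z\rangle$. Outer scheme (VIJI) with surrogates $J_k\in\mathbb R^{d\times d}$, model level $\delta\ge0$ and dual-step parameters $\rho_k\ge0$. Choose $z_0\in\mathcal Z$, $\sigma_0=0\in\mathbb R^d$. For $k=0,\dots,T-1$: (1) $v_k=\arg\max_{v\in\mathcal Z}\{\langle\sigma_k,v-z_0\rangle-\frac12\|v-z_0\|^2\}$;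 (2) take any $x_k\in\mathcal Z$ with $$\sup_{z\in\mathcal Z}\langle\Omega_{v_k,J_k,\delta}(x_k),x_k-z\rangle\le\frac{L_1}{2}\|x_k-v_k\|^3+\delta\|x_k-v_k\|^2,$$ where $\Omega_{v,J,\delta}(x)=F(v)+J(x-v)+(10\delta+5L_1\|x-v\|)(x-v)$; (3) choose $\lambda_k>0$ with $\frac1{32}\le\lambda_k\left(\frac{L_1}{2}\|x_k-v_k\|+\rho_k\right)\le\frac1{22}$; (4) $\sigma_{k+1}=\sigma_k-\lambda_kF(x_k)$. Output $\widetilde z_T=\left(\sum_{k=0}^{T-1}\lambda_k\right)^{-1}\sum_{k=0}^{T-1}\lambda_kx_k$. If the bracket in (3) is zero, the scheme stops and outputs $\widetilde z_T:=x_k$. *)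

(* Defs.v *)
From HB Require Import structures.
From mathcomp Require Import all_boot all_order all_algebra.
From mathcomp Require Import all_classical all_reals all_analysis.

Set Implicit Arguments.
Unset Strict Implicit.
Unset Printing Implicit Defensive.

Import Order.TTheory GRing.Theory Num.Theory.
Import numFieldNormedType.Exports.

Local Open Scope classical_set_scope.
Local Open Scope ring_scope.

Section Euclidean.
Context {R : realType} {d : nat}.
Implicit Types (u v x y : 'cV[R]_d) (A : 'M[R]_d) (Z : set 'cV[R]_d).

Definition dot u v : R := \sum_(i < d) u i 0 * v i 0.

(* The library norm `|u| on matrices is the sup norm; it induces the same
   topology, so compactness and continuity below are the usual notions. *)
Definition enorm u : R := Num.sqrt (dot u u).

Definition opnorm A : R := sup [set enorm (A *m u) | u in [set u | enorm u <= 1]].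

Definition diam Z : R := sup [set enorm (p.1 - p.2) | p in Z `*` Z].

End Euclidean.

Section Operators.
Context {R : realType} {d : nat}.
Implicit Types (Z : set 'cV[R]_d) (F : 'cV[R]_d -> 'cV[R]_d)
  (dF : 'cV[R]_d -> 'M[R]_d).

(* F is continuously differentiable on Z with Jacobian field dF.  Derivatives
   are taken relative to Z, so only the values of F on Z matter.  If F is C^1 on
   a neighbourhood of Z, its usual Jacobian field qualifies; if Z is convex with
   nonempty interior, dF is determined by F on Z. *)
Definition C1_on Z F dF : Prop :=
  (forall x, Z x -> forall eps : R, 0 < eps ->
     \forall y \near within Z (nbhs x),
       enorm (F y - F x - dF x *m (y - x)) <= eps * enorm (y - x))
  /\ {within Z, continuous dF}.

Definition monotone_on Z F : Prop :=
  forall x y, Z x -> Z y -> 0 <= dot (F x - F y) (x - y).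

Definition op_lipschitz_on Z dF (L : R) : Prop :=
  forall x y, Z x -> Z y -> opnorm (dF x - dF y) <= L * enorm (x - y).

Definition gap Z F (zhat : 'cV[R]_d) : R :=
  sup [set dot (F z) (zhat - z) | z in Z].

Definition is_argmax_on Z (f : 'cV[R]_d -> R) (v : 'cV[R]_d) : Prop :=
  Z v /\ forall u, Z u -> f u <= f v.

End Operators.

Section VIJI.
Context {R : realType} {d : nat}.
Variables (Z : set 'cV[R]_d) (F : 'cV[R]_d -> 'cV[R]_d) (L1 delta : R).
Variables (J : nat -> 'M[R]_d) (rho : nat -> R) (T : nat).
Variables (z0 : 'cV[R]_d) (v x sigma : nat -> 'cV[R]_d) (lam : nat -> R).

Definition viji_model (vk : 'cV[R]_d) (Jk : 'M[R]_d) (y : 'cV[R]_d) : 'cV[R]_d :=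
  F vk + Jk *m (y - vk)
    + (10 * delta + 5 * L1 * enorm (y - vk)) *: (y - vk).

Definition viji_bracket (k : nat) : R := L1 / 2 * enorm (x k - v k) + rho k.

(* The number of iterations in which all four steps are carried out: the first
   k < T whose bracket vanishes (early stop), or T if there is none. *)
Definition viji_length : nat :=
  find (fun k => viji_bracket k == 0) (iota 0 T).

(* Iteration k takes place (at least its first two steps). *)
Definition viji_reached (k : nat) : bool := (k < T)%N && (k <= viji_length)%N.

(* (v, x, sigma, lam) is an admissible trace; entries past the end of the run
   are unconstrained. *)
Record viji_run : Prop := VijiRun {
  viji_start : Z z0 ;
  viji_sigma0 : sigma 0%N = 0 ;
  viji_argmax : forall k, viji_reached k ->
    is_argmax_on Z
      (fun u => dot (sigma k) (u - z0) - 2^-1 * enorm (u - z0) ^+ 2) (v k) ;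
  viji_point : forall k, viji_reached k -> Z (x k) ;
  viji_inexact : forall k, viji_reached k ->
    sup [set dot (viji_model (v k) (J k) (x k)) (x k - z) | z in Z]
      <= L1 / 2 * enorm (x k - v k) ^+ 3 + delta * enorm (x k - v k) ^+ 2 ;
  viji_lam_gt0 : forall k, (k < viji_length)%N -> 0 < lam k ;
  viji_lam_bounds : forall k, (k < viji_length)%N ->
    32^-1 <= lam k * viji_bracket k <= 22^-1 ;
  viji_dual : forall k, (k < viji_length)%N ->
    sigma k.+1 = sigma k - lam k *: F (x k)
}.

Definition viji_output : 'cV[R]_d :=
  if (viji_length < T)%N then x viji_length
  else (\sum_(k < T) lam k)^-1 *: \sum_(k < T) lam k *: x k.

End VIJI.

(* Main.v *)
Require Import Defs.
From HB Require Import structures.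
From mathcomp Require Import all_boot all_order all_algebra.
From mathcomp Require Import all_classical all_reals all_analysis.
From mathcomp Require Import ring lra.

Set Implicit Arguments.
Unset Strict Implicit.
Unset Printing Implicit Defensive.

Import Order.TTheory GRing.Theory Num.Theory.
Import numFieldNormedType.Exports.

Local Open Scope classical_set_scope.
Local Open Scope ring_scope.

(** Write [r_k = |x_k - v_k|] and [a_k = L1 / 2 * r_k + beta].

    The two ways in which the local model of [F] at [v_k] is wrong, namely the
    second order Taylor remainder ([first_order_remainder_le]) and the use of
    the Jacobian of [F_1] instead of that of [F] (at most [beta] in operator
    norm), add up to an error of at most [a_k * r_k] at [x_k]
    ([model_error_le]).  The regularisation of the model is
    [10 * a_k * (x_k - v_k)]: it is proportional to the same [a_k], and
    dominates that error.  Since [lam_k * a_k] lies in [[1/32, 1/22]], one step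
    of dual extrapolation therefore satisfies, for all [u] in [Z]
    ([dual_step_decrease]),
      [lam_k <F(x_k), x_k - u> - |u - v_k|^2 / 2 <= - r_k^2 / 8].

    The step maximises a 1-strongly concave function, so these inequalities
    telescope ([regret_le]): for all [z] in [Z],
      [Sum_k lam_k <F(x_k), x_k - z> <= |z - z_0|^2 / 2 - Sum_k r_k^2 / 8].
    By monotonicity the left side is at least [Lam * q], where
    [Lam = Sum_k lam_k] and [q = <F(z), output - z>].  Fix [z].  If [q <= 0]
    nothing is left to prove.  If [q > 0], the inequality gives at once
    [Lam * q <= D^2 / 2] and [Sum_k r_k^2 <= 4 D^2]; so the very
    point [z] at which the gap is tested also controls the displacements.  By
    Cauchy-Schwarz, [Sum_k a_k <= L1 D sqrt T + beta T], and
    [lam_k a_k >= 1/32] gives [T^2 <= 32 Lam Sum_k a_k], again by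
    Cauchy-Schwarz.  Hence
      [q <= 16 D^2 (L1 D sqrt T + beta T) / T^2]  ([full_run_gap_le]),
    which implies the claimed rate because [1 <= sqrt 2].

    If the run stops early, the bracket [a_N] vanishes, so [x_N = v_N], and the
    subproblem says that [x_N] solves the variational inequality
    ([early_stop_gap_le0]).

    Compactness of [Z] enters through the suprema: they are taken in the reals,
    and bound their sets only because these are bounded above. *)

(** * Euclidean geometry and the operator norm *)

Section Euclid.
Context {R : realType}.

(** Lagrange's identity: the difference of the two sides is half the sum of the
    squares [(f i * g j - f j * g i) ^+ 2]. *)
Lemma sum_CauchySchwarz (I : finType) (f g : I -> R) :
  (\sum_i f i * g i) ^+ 2 <= (\sum_i f i ^+ 2) * (\sum_i g i ^+ 2).
Proof.
have : 0 <= \sum_i \sum_j (f i * g j - f j * g i) ^+ 2.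
  by apply: sumr_ge0 => i _; apply: sumr_ge0 => j _; exact: sqr_ge0.
have -> : \sum_i \sum_j (f i * g j - f j * g i) ^+ 2 =
    \sum_i \sum_j (f i ^+ 2 * g j ^+ 2) + \sum_i \sum_j (f j ^+ 2 * g i ^+ 2)
    - 2 * \sum_i \sum_j ((f i * g i) * (f j * g j)).
  rewrite mulr_sumr -sumrN -!big_split /=; apply: eq_bigr => i _.
  rewrite mulr_sumr -sumrN -!big_split /=; apply: eq_bigr => j _.
  by ring.
rewrite [X in _ + X - _]exchange_big /= -!big_distrlr /= -expr2.
lra.
Qed.

Context {d : nat}.
Implicit Types (u v p : 'cV[R]_d) (A B : 'M[R]_d) (Z : set 'cV[R]_d).

Lemma dotC u v : dot u v = dot v u.
Proof. by apply: eq_bigr => i _; rewrite mulrC. Qed.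

Lemma dotDl u v p : dot (u + v) p = dot u p + dot v p.
Proof. by rewrite -big_split; apply: eq_bigr => i _; rewrite mxE mulrDl. Qed.

Lemma dotZl c u v : dot (c *: u) v = c * dot u v.
Proof. by rewrite [RHS]mulr_sumr; apply: eq_bigr => i _; rewrite mxE mulrA. Qed.

Lemma dotNl u v : dot (- u) v = - dot u v.
Proof. by rewrite -scaleN1r dotZl mulN1r. Qed.

Lemma dotDr u v p : dot p (u + v) = dot p u + dot p v.
Proof. by rewrite !(dotC p) dotDl. Qed.

Lemma dotZr c u v : dot u (c *: v) = c * dot u v.
Proof. by rewrite !(dotC u) dotZl. Qed.

Lemma dotNr u v : dot u (- v) = - dot u v.
Proof. by rewrite !(dotC u) dotNl. Qed.

Definition dotE := (dotDl, dotDr, dotNl, dotNr, dotZl, dotZr).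

Lemma dot0l v : dot 0 v = 0.
Proof. by rewrite -(scale0r v) dotZl mul0r. Qed.

Lemma dot_suml (I : Type) (r : seq I) (P : pred I) (f : I -> 'cV[R]_d) v :
  dot (\sum_(i <- r | P i) f i) v = \sum_(i <- r | P i) dot (f i) v.
Proof.
elim/big_rec2: _ => [|i a b _ <-]; last by rewrite dotDl.
by rewrite dot0l.
Qed.

Lemma dot_ge0 u : 0 <= dot u u.
Proof. by apply: sumr_ge0 => i _; rewrite -expr2 sqr_ge0. Qed.

Lemma enorm_ge0 u : 0 <= enorm u.
Proof. exact: sqrtr_ge0. Qed.
Hint Resolve enorm_ge0 : core.

Lemma enorm_sqr u : enorm u ^+ 2 = dot u u.
Proof. by rewrite sqr_sqrtr ?dot_ge0. Qed.

Lemma dot_abs_le u v : `|dot u v| <= enorm u * enorm v.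
Proof.
rewrite -ler_sqr ?nnegrE ?mulr_ge0//.
rewrite real_normK ?num_real// exprMn !enorm_sqr.
exact: sum_CauchySchwarz.
Qed.

Lemma dot_le_enorm u v : dot u v <= enorm u * enorm v.
Proof. exact: le_trans (ler_norm _) (dot_abs_le u v). Qed.

Lemma enormZ c u : enorm (c *: u) = `|c| * enorm u.
Proof.
by rewrite /enorm dotZl dotZr mulrA -expr2 sqrtrM ?sqr_ge0// sqrtr_sqr.
Qed.

Lemma enormN u : enorm (- u) = enorm u.
Proof. by rewrite -scaleN1r enormZ normrN1 mul1r. Qed.

Lemma enorm0 : enorm (0 : 'cV[R]_d) = 0.
Proof. by rewrite -(scale0r 0) enormZ normr0 mul0r. Qed.

Lemma enorm_eq0 u : enorm u = 0 -> u = 0.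
Proof.
move=> u0; have /eqP : dot u u = 0 by rewrite -enorm_sqr u0 expr0n.
rewrite psumr_eq0 => [/allP u00|i _]; last by rewrite -expr2 sqr_ge0.
apply/colP => i; rewrite mxE; apply/eqP.
by have /= := u00 i (mem_index_enum _); rewrite mulf_eq0 orbb.
Qed.

Lemma enormD u v : enorm (u + v) <= enorm u + enorm v.
Proof.
rewrite -ler_sqr ?nnegrE ?addr_ge0// enorm_sqr !dotE (dotC v u).
have := dot_le_enorm u v; rewrite sqrrD !enorm_sqr; lra.
Qed.

Lemma enorm_sum (I : Type) (r : seq I) (f : I -> 'cV[R]_d) :
  enorm (\sum_(i <- r) f i) <= \sum_(i <- r) enorm (f i).
Proof.
elim/big_rec2: _ => [|i a b _ le_ba]; first by rewrite enorm0.
by apply: (le_trans (enormD _ _)); rewrite lerD2l.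
Qed.

Lemma mx_entry_le (m n : nat) (A : 'M[R]_(m, n)) i j : `|A i j| <= `|A|.
Proof.
have /(_ (i, j)) := @le_bigmax _ _ _ (0 : R) (fun ij => `|A ij.1 ij.2|).
by rewrite -mx_normrE.
Qed.

(** Boundedness on compact sets is known for the sup norm of matrices; this and
    the next lemmas transfer it to [enorm] and [opnorm]. *)
Lemma enorm_mulmx_le_mx_norm A u : enorm (A *m u) <= d%:R * `|A| * enorm u.
Proof.
rewrite -ler_sqr ?nnegrE ?mulr_ge0// !exprMn !enorm_sqr.
have row_le i : (A *m u) i 0 ^+ 2 <= (d%:R * `|A| ^+ 2) * dot u u.
  rewrite mxE; apply: (le_trans (sum_CauchySchwarz _ _)).
  have -> : \sum_j u j 0 ^+ 2 = dot u u by apply: eq_bigr => j _; rewrite expr2.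
  rewrite ler_wpM2r ?dot_ge0//; apply: (le_trans (y := \sum_(j < d) `|A| ^+ 2)).
    apply: ler_sum => j _; rewrite -real_normK ?num_real//.
    by rewrite lerXn2r ?nnegrE// mx_entry_le.
  by rewrite sumr_const card_ord mulr_natl.
have -> : d%:R ^+ 2 * `|A| ^+ 2 * dot u u =
    \sum_(i < d) (d%:R * `|A| ^+ 2) * dot u u.
  rewrite sumr_const card_ord -mulr_natl; ring.
by apply: ler_sum => i _; rewrite -expr2.
Qed.

Lemma enorm_le_mx_norm u : enorm u <= d%:R * `|u|.
Proof.
rewrite -ler_sqr ?nnegrE ?mulr_ge0// exprMn enorm_sqr.
apply: (le_trans (y := \sum_(i < d) `|u| ^+ 2)).
  apply: ler_sum => i _; rewrite -expr2 -real_normK ?num_real//.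
  by rewrite lerXn2r ?nnegrE// mx_entry_le.
rewrite sumr_const card_ord -[_ *+ d]mulr_natl ler_wpM2r ?sqr_ge0//.
by rewrite -natrX ler_nat; case: (d) => // n; rewrite leq_pmulr.
Qed.

Lemma opnorm_has_ubound A :
  has_ubound [set enorm (A *m u) | u in [set u | enorm u <= 1]].
Proof.
exists (d%:R * `|A|) => _ [u /= u1 <-].
apply: (le_trans (enorm_mulmx_le_mx_norm A u)).
by rewrite -[leRHS]mulr1 ler_wpM2l// mulr_ge0.
Qed.

Lemma opnorm_ge0 A : 0 <= opnorm A.
Proof.
apply: (ub_le_sup (opnorm_has_ubound A)); exists 0.
  by rewrite /= enorm0.
by rewrite mulmx0 enorm0.
Qed.

Lemma opnorm_le_mx_norm A : opnorm A <= d%:R * `|A|.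
Proof.
apply: ge_sup => [|_ [u /= u1 <-]].
  by exists (enorm (A *m 0)), 0; rewrite //= enorm0.
apply: (le_trans (enorm_mulmx_le_mx_norm A u)).
by rewrite -[leRHS]mulr1 ler_wpM2l// mulr_ge0.
Qed.

Lemma enorm_mulmx_le A u : enorm (A *m u) <= opnorm A * enorm u.
Proof.
have [u0|u0] := eqVneq (enorm u) 0.
  by have := enorm_mulmx_le_mx_norm A u; rewrite u0 !mulr0.
have ugt0 : 0 < enorm u by rewrite lt_neqAle eq_sym u0 enorm_ge0.
rewrite -ler_pdivrMr//.
have -> : enorm (A *m u) / enorm u = enorm (A *m ((enorm u)^-1 *: u)).
  by rewrite -scalemxAr enormZ gtr0_norm ?invr_gt0// mulrC.
apply: (ub_le_sup (opnorm_has_ubound A)); exists ((enorm u)^-1 *: u) => //=.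
by rewrite enormZ gtr0_norm ?invr_gt0// mulVf.
Qed.

Lemma compact_enorm_bounded Z : compact Z ->
  exists C, forall z, Z z -> enorm z <= C.
Proof.
move=> /compact_bounded/pinfty_ex_gt0[C C0 ZC]; exists (d%:R * C) => z Zz.
by apply: (le_trans (enorm_le_mx_norm z)); rewrite ler_wpM2l//; exact: ZC.
Qed.

Lemma enorm_le_diam Z u v : compact Z -> Z u -> Z v -> enorm (u - v) <= diam Z.
Proof.
move=> /compact_enorm_bounded[C ZC] Zu Zv.
apply: ub_le_sup; last by exists (u, v).
exists (C + C) => _ [[a b] [/= /ZC aC /ZC bC] <-].
by apply: (le_trans (enormD _ _)); rewrite enormN lerD.
Qed.

Lemma dot_le_sup Z a u z : compact Z -> Z z ->
  dot a (u - z) <= sup [set dot a (u - y) | y in Z].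
Proof.
move=> /compact_enorm_bounded[C ZC] Zz; apply: ub_le_sup; last by exists z.
exists (enorm a * (enorm u + C)) => _ [y /ZC yC <-].
apply: (le_trans (dot_le_enorm _ _)); rewrite ler_wpM2l//.
by apply: (le_trans (enormD _ _)); rewrite enormN lerD.
Qed.

Lemma opnorm_le_sup Z (dG : 'cV[R]_d -> 'M[R]_d) z : compact Z ->
  {within Z, continuous dG} -> Z z ->
  opnorm (dG z) <= sup [set opnorm (dG y) | y in Z].
Proof.
move=> cptZ cdG Zz; apply: ub_le_sup; last by exists z.
have /compact_bounded/pinfty_ex_gt0[C C0 ZC] : compact (dG @` Z).
  exact: continuous_compact.
exists (d%:R * C) => _ [y Zy <-].
apply: (le_trans (opnorm_le_mx_norm _)); rewrite ler_wpM2l//.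
by apply: ZC; exists y.
Qed.

End Euclid.

#[local] Hint Extern 0 (is_true (0 <= enorm _)) => exact: enorm_ge0 : core.

(** * First order expansions along segments *)

Section Taylor.
Context {R : realType} {d : nat}.
Implicit Types (u v p : 'cV[R]_d) (Z : set 'cV[R]_d).

Definition has_jacobian_on Z (F : 'cV[R]_d -> 'cV[R]_d) dF : Prop :=
  forall p, Z p -> forall eps : R, 0 < eps ->
    \forall y \near within Z (nbhs p),
      enorm (F y - F p - dF p *m (y - p)) <= eps * enorm (y - p).

Lemma convex_segment Z u v (t : R) : convex_set Z -> Z u -> Z v ->
  0 <= t <= 1 -> Z (v + t *: (u - v)).
Proof.
move=> cvxZ Zu Zv /andP[t0 t1].
have /set_mem := cvxZ u v (Itv01 t0 t1) (mem_set Zu) (mem_set Zv).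
congr (Z _); rewrite /conv /= /unstable.onem scalerBr scalerBl scale1r addrC.
by rewrite -addrA (addrC (- _)).
Qed.

(** The mean value theorem for [f t - c / 2 * t ^+ 2] on [[0, 1]].  The
    derivative is given by expansions relative to the segment because [f] comes
    from a map that is only known on a set containing the segment. *)
Lemma segment_growth_le (f df : R -> R) (c : R) :
  (forall t : R, 0 <= t <= 1 -> forall eps : R, 0 < eps ->
    \forall s \near within `[0, 1] (nbhs t),
      `|f s - f t - df t * (s - t)| <= eps * `|s - t|) ->
  (forall t : R, 0 <= t <= 1 -> df t <= c * t) -> f 1 - f 0 <= c / 2.
Proof.
move=> fexp dfc.
have fder (t : R) : t \in `]0, 1[ -> is_derive t 1 f (df t).
  move=> t01; have t01' : 0 <= t <= 1.
    by move: t01; rewrite in_itv /= => /andP[/ltW-> /ltW->].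
  have fcvg : h^-1 *: (f (h *: 1 + t) - f t) @[h --> 0^'] --> df t.
    apply/cvgrPdist_le => eps eps0.
    have /nbhs_ballP[r /= r0 tr] : \forall s \near t,
        `|f s - f t - df t * (s - t)| <= eps * `|s - t|.
      near=> s; have : `[0, 1]%classic s.
        by apply: subset_itv_oo_cc; near: s; exact: near_in_itvoo.
      near: s; exact: (fexp t t01' eps eps0).
    near=> h.
    have h0 : h != 0 by near: h; exact: nbhs_dnbhs_neq.
    have /tr : ball t r (h *: 1 + t).
      rewrite /ball /= [_ *: _]mulr1 opprD addrCA subrr addr0 normrN.
      by near: h; apply: dnbhs0_lt.
    rewrite [h *: 1]mulr1 addrK => H.
    rewrite distrC -(ler_pM2r (x := `|h|)) ?normr_gt0// -normrM.
    by rewrite mulrBl [_ *: _]mulrC mulfVK//.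
  by apply: DeriveDef; [exact: (cvgP _ fcvg)|exact: (cvg_lim _ fcvg)].
have fcont : {within `[0, 1], continuous f}.
  apply/subspace_continuousP => t; rewrite /= in_itv/= => t01.
  apply/cvgrPdist_le => eps eps0.
  near=> s.
  have : `|f s - f t - df t * (s - t)| <= 1 * `|s - t|.
    by near: s; exact: fexp.
  have : `|s - t| <= eps / (1 + `|df t|).
    rewrite distrC; near: s; apply: cvg_within; near=> s; apply: ltW.
    by near: s; apply: nbhsx_ballx; rewrite divr_gt0// ltr_pwDl.
  rewrite ler_pdivlMr ?ltr_pwDl// => st fst.
  have -> : f t - f s =
    - ((f s - f t - df t * (s - t)) + df t * (s - t)) by ring.
  rewrite normrN; apply: (le_trans (ler_normD _ _)); rewrite normrM.
  move: fst st; rewrite mul1r; nra.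
have gder (t : R) : t \in `]0, 1[ ->
    is_derive t 1 (fun s => f s - c / 2 * s ^+ 2) (df t - c * t).
  by move=> /fder dft; apply: is_derive_eq; rewrite /GRing.scale/=; field.
have [|t t01] := MVT ltr01 gder.
  apply: within_continuousB => //; apply: continuous_subspaceT => t.
  by apply: cvgM; [exact: cvg_cst|exact: exprn_continuous].
rewrite subr0 mulr1 => gE.
have : df t <= c * t.
  by apply: dfc; move: t01; rewrite in_itv /= => /andP[/ltW-> /ltW->].
lra.
Unshelve. all: by end_near.
Qed.

Lemma has_jacobian_on_sum (I : finType) Z (w : I -> R)
    (G : I -> 'cV[R]_d -> 'cV[R]_d) (dG : I -> 'cV[R]_d -> 'M[R]_d) :
  (forall i, 0 <= w i) -> \sum_i w i = 1 ->
  (forall i, has_jacobian_on Z (G i) (dG i)) ->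
  has_jacobian_on Z (fun z => \sum_i w i *: G i z)
                    (fun z => \sum_i w i *: dG i z).
Proof.
move=> w0 w1 Gexp u Zu eps eps0.
have : \forall y \near within Z (nbhs u), forall i,
    enorm (G i y - G i u - dG i u *m (y - u)) <= eps * enorm (y - u).
  by apply: filter_forall => i; exact: Gexp.
apply: filterS => y yexp.
rewrite mulmx_suml -!sumrB; apply: (le_trans (enorm_sum _ _)).
rewrite -[leRHS]mul1r -w1 mulr_suml; apply: ler_sum => i _.
by rewrite -scalemxAl -!scalerBr enormZ ger0_norm// ler_wpM2l.
Qed.

Lemma within_continuous_sum (I : finType) Z (w : I -> R)
    (dG : I -> 'cV[R]_d -> 'M[R]_d) :
  (forall i, {within Z, continuous (dG i)}) ->
  {within Z, continuous (fun z => \sum_i w i *: dG i z)}.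
Proof.
move=> dGc.
have -> : (fun z => \sum_i w i *: dG i z) = \sum_i (fun z => w i *: dG i z).
  by apply/funext => z; rewrite fct_sumE.
elim/big_ind : _ => [|f g fc gc|i _]; [|exact: within_continuousD|].
  by move=> p; exact: cvg_cst.
by move=> p; apply: cvgZl_tmp; exact: dGc.
Qed.

(** The remainder [e] satisfies [|e|^2 = f 1 - f 0] for the scalar function [f]
    below, which up to a constant is the remainder along the segment from [v] to
    [u], projected on [e]; by the Lipschitz bound the derivative of [f] at [t]
    is at most [t * L * |u - v|^2 * |e|]. *)
Lemma first_order_remainder_le Z (F : 'cV[R]_d -> 'cV[R]_d) dF (L : R) u v :
  0 <= L -> convex_set Z ->
  has_jacobian_on Z F dF ->
  op_lipschitz_on Z dF L -> Z u -> Z v ->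
  enorm (F u - F v - dF v *m (u - v)) <= L / 2 * enorm (u - v) ^+ 2.
Proof.
move=> L0 cvxZ Fexp lipF Zu Zv.
set e := F u - F v - dF v *m (u - v); set r := enorm (u - v).
have r1 : 0 < 1 + r by rewrite ltr_pwDl// enorm_ge0.
pose g (t : R) := v + t *: (u - v).
have gZ t : 0 <= t <= 1 -> Z (g t) by exact: convex_segment.
have gB s t : g s - g t = (s - t) *: (u - v).
  by rewrite /g scalerBl opprD addrACA subrr add0r.
have g0 : g 0 = v by rewrite /g scale0r addr0.
have g1 : g 1 = u by rewrite /g scale1r addrC subrK.
have gcont : continuous g.
  by move=> t; apply: cvgD; [exact: cvg_cst|apply: cvgZr_tmp].
have [e0|e0] := eqVneq (enorm e) 0.
  by rewrite e0 mulr_ge0 ?sqr_ge0// divr_ge0.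
have egt0 : 0 < enorm e by rewrite lt_neqAle eq_sym e0 enorm_ge0.
pose f t := dot (F (g t) - t *: (dF v *m (u - v))) e.
pose df t := dot ((dF (g t) - dF v) *m (u - v)) e.
suff : f 1 - f 0 <= (L * r ^+ 2 * enorm e) / 2.
  rewrite /f g0 g1 scale1r scale0r subr0 -dotNl -dotDl addrAC -/e -enorm_sqr.
  move=> H; rewrite -(ler_pM2r egt0) -expr2; apply: (le_trans H).
  by rewrite le_eqVlt; apply/orP; left; apply/eqP; field.
apply: (segment_growth_le (df := df)) => [t t01 eps eps0|t t01].
  (* The denominator turns the Cauchy-Schwarz bound [|.| * |e|] with
     [|g s - g t| = |s - t| * r] into [eps * |s - t|]; [1 + r] instead of [r]
     keeps it nonzero when [u = v]. *)
  have : \forall s \near within `[0, 1] (nbhs t),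
    enorm (F (g s) - F (g t) - dF (g t) *m (g s - g t)) <=
      (eps / (enorm e * (1 + r))) * enorm (g s - g t).
    have : \forall y \near within Z (nbhs (g t)),
      enorm (F y - F (g t) - dF (g t) *m (y - g t)) <=
      (eps / (enorm e * (1 + r))) * enorm (y - g t).
      apply: Fexp; first exact: gZ.
      by rewrite divr_gt0// mulr_gt0.
    rewrite near_withinE => /(gcont t) H; rewrite near_withinE.
    near=> s; rewrite /= in_itv/= => /gZ; near: s; exact: H.
  apply: filterS => s H.
  have -> : f s - f t - df t * (s - t) =
      dot (F (g s) - F (g t) - dF (g t) *m (g s - g t)) e.
    rewrite /f /df gB -scalemxAr mulmxBl !dotE; ring.
  apply: (le_trans (dot_abs_le _ _)); rewrite -ler_pdivlMr//.
  apply: (le_trans H); rewrite gB enormZ -/r.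
  have -> : eps / (enorm e * (1 + r)) * (`|s - t| * r) =
      eps * `|s - t| / enorm e * (r / (1 + r)) by field; rewrite e0 gt_eqF.
  apply: ler_piMr; first by rewrite divr_ge0 ?mulr_ge0 ?(ltW eps0).
  by rewrite ler_pdivrMr// mul1r lerDr.
rewrite mulrAC; apply: (le_trans (dot_le_enorm _ _)); rewrite ler_wpM2r//.
apply: (le_trans (enorm_mulmx_le _ _)).
have := lipF _ _ (gZ t t01) Zv.
rewrite -{2}g0 gB subr0 enormZ ger0_norm; last by case/andP: t01.
move=> /(ler_wpM2r (enorm_ge0 (u - v)))/le_trans; apply.
by rewrite -/r le_eqVlt; apply/orP; left; apply/eqP; ring.
Unshelve. all: by end_near.
Qed.
End Taylor.

(** * One dual extrapolation step, the regret, and the gap *)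

Section Viji.
Context {R : realType} {d : nat}.
Implicit Types (u x v z : 'cV[R]_d) (Z : set 'cV[R]_d).

(** The quadratic has curvature one, so its expansion at [v] is exact;
    optimality along the segment from [v] to [u] forces the linear term
    to be nonpositive. *)
Lemma argmax_quadratic_growth Z (g z0 u v : 'cV[R]_d) : convex_set Z ->
  is_argmax_on Z (fun p => dot g (p - z0) - 2^-1 * enorm (p - z0) ^+ 2) v ->
  Z u ->
  dot g (u - z0) - 2^-1 * enorm (u - z0) ^+ 2 <=
  dot g (v - z0) - 2^-1 * enorm (v - z0) ^+ 2 - 2^-1 * enorm (u - v) ^+ 2.
Proof.
move=> cvxZ [Zv vmax] Zu.
pose c := dot (g - (v - z0)) (u - v); pose s2 := enorm (u - v) ^+ 2.
have expand (t : R) : dot g (v + t *: (u - v) - z0)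
      - 2^-1 * enorm (v + t *: (u - v) - z0) ^+ 2 =
    dot g (v - z0) - 2^-1 * enorm (v - z0) ^+ 2 + t * c - t ^+ 2 / 2 * s2.
  rewrite addrAC; rewrite /c /s2 !enorm_sqr [dot (g - _) _]dotDl dotNl.
  move: (v - z0) (u - v) => p q; rewrite !dotE (dotC q p); by field.
have c_le (t : R) : 0 < t <= 1 -> c <= t * (s2 / 2).
  move=> /andP[t0 t1]; have t01 : 0 <= t <= 1 by rewrite (ltW t0).
  have := vmax _ (convex_segment cvxZ Zu Zv t01); rewrite expand.
  rewrite -addrA gerDl subr_le0 => tc_le; rewrite -(ler_pM2l t0).
  by have -> : t * (t * (s2 / 2)) = t ^+ 2 / 2 * s2 by field.
have c0 : c <= 0.
  rewrite leNgt; apply/negP => cgt0.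
  have s20 : 0 < s2 by have := c_le 1; rewrite ltr01 lexx => /(_ isT); lra.
  (* With [t] at most [c / s2], the bound [c <= t * (s2 / 2)] gives
     [c <= c / 2]. *)
  have := c_le (Num.min 1 (c / s2)).
  rewrite lt_min ltr01 divr_gt0// ge_min lexx => /(_ isT).
  have : Num.min 1 (c / s2) <= c / s2 by rewrite ge_min lexx orbT.
  move=> /(ler_wpM2r (ltW s20)); rewrite divfK ?gt_eqF//; lra.
have := expand 1; rewrite scale1r [v + _]addrC subrK => ->; rewrite /s2; lra.
Qed.

(** With [s = |u - v|], the model error, the inexactness and the regularisation
    contribute at most [a r (r + s)], [a r^2] and [- 10 a (r^2 - r s)] to
    [<F x, x - u>], which leaves [a (11 r s - 8 r^2)].  The cross term, once
    multiplied by [lam], is absorbed by [s^2 / 2]. *)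
Lemma dual_step_decrease (F : 'cV[R]_d -> 'cV[R]_d) (J : 'M[R]_d)
    (L delta lam : R) u v x :
  let r := enorm (x - v) in let a := L / 2 * r + delta in
  0 < lam -> 32^-1 <= lam * a <= 22^-1 ->
  enorm (F x - F v - J *m (x - v)) <= a * r ->
  dot (viji_model F L delta v J x) (x - u) <= L / 2 * r ^+ 3 + delta * r ^+ 2 ->
  lam * dot (F x) (x - u) - 2^-1 * enorm (u - v) ^+ 2 <= - (8^-1 * r ^+ 2).
Proof.
move=> r a lam0 /andP[la1 la2] rem inexact.
set s := enorm (u - v); have r0 : 0 <= r := enorm_ge0 _.
have s0 : 0 <= s := enorm_ge0 _.
have a0 : 0 < a by rewrite -(pmulr_rgt0 _ lam0); lra.
have modelE : dot (viji_model F L delta v J x) (x - u) =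
    dot (F x) (x - u) - dot (F x - F v - J *m (x - v)) (x - u)
    + 10 * a * dot (x - v) (x - u).
  rewrite /viji_model -/r /a !(dotDl, dotNl, dotZl); by field.
have xuE : x - u = (x - v) - (u - v) by rewrite opprB addrA subrK.
have xu_le : enorm (x - u) <= r + s.
  by rewrite xuE (le_trans (enormD _ _))// enormN.
have inner_ge : r ^+ 2 - r * s <= dot (x - v) (x - u).
  rewrite xuE dotDr dotNr -enorm_sqr lerD2l lerN2; exact: dot_le_enorm.
have err_le : dot (F x - F v - J *m (x - v)) (x - u) <= a * r * (r + s).
  apply: (le_trans (dot_le_enorm _ _)).
  exact: ler_pM.
have F_le : dot (F x) (x - u) <= a * (11 * (r * s) - 8 * r ^+ 2).
  move: inexact; rewrite modelE.
  have -> : L / 2 * r ^+ 3 + delta * r ^+ 2 = a * r ^+ 2 by rewrite /a; ring.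
  have := ler_wpM2l (ltW a0) inner_ge; lra.
have := ler_wpM2l (ltW lam0) F_le; rewrite [leRHS]mulrA.
set t := lam * a in la1 la2 *.
have := sqr_ge0 (11 * t * r - s); have := sqr_ge0 r.
(* [11 t r s <= s^2 / 2 + (11 t r)^2 / 2], and [t (8 - 121 / 2 t)] is at least
   [21 / 128] for [t] between [1 / 32] and [1 / 22]. *)
have : t * (8 - 121 / 2 * t) * r ^+ 2 >= 8^-1 * r ^+ 2.
  by rewrite ler_wpM2r ?sqr_ge0//; nra.
lra.
Qed.

Lemma viji_length_le (L : R) rho T (v x : nat -> 'cV[R]_d) :
  (viji_length L rho T v x <= T)%N.
Proof. by rewrite -[leqRHS](size_iota 0) find_size. Qed.

Lemma lt_length_reached (L : R) rho T (v x : nat -> 'cV[R]_d) k :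
  (k < viji_length L rho T v x)%N -> viji_reached L rho T v x k.
Proof.
by move=> kN; rewrite /viji_reached (ltnW kN) (leq_trans kN)// viji_length_le.
Qed.

Lemma bracket_length_eq0 (L : R) rho T (v x : nat -> 'cV[R]_d) :
  (viji_length L rho T v x < T)%N ->
  viji_bracket L rho v x (viji_length L rho T v x) = 0.
Proof.
move=> NT; have := nth_find 0%N
  (a := fun k => viji_bracket L rho v x k == 0) (s := iota 0 T).
by rewrite has_find size_iota => /(_ NT); rewrite nth_iota// => /eqP.
Qed.

Section Run.
Context (Z : set 'cV[R]_d) (F : 'cV[R]_d -> 'cV[R]_d).
Context (dF : 'cV[R]_d -> 'M[R]_d).
Context (L delta : R) (J : nat -> 'M[R]_d) (T : nat) (z0 : 'cV[R]_d).
Context (v x sigma : nat -> 'cV[R]_d) (lam : nat -> R).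

Let rho (_ : nat) := delta.
Let N := viji_length L rho T v x.
Let r k := enorm (x k - v k).
Let a k := L / 2 * r k + delta.

Context (cptZ : compact Z) (cvxZ : convex_set Z).
Context (L0 : 0 < L) (delta0 : 0 <= delta).
Context (mono : monotone_on Z F) (lip : op_lipschitz_on Z dF L).
Context (diff : has_jacobian_on Z F dF).
Context (J_le : forall k, viji_reached L rho T v x k ->
  opnorm (dF (v k) - J k) <= delta).
Context (run : viji_run Z F L delta J rho T z0 v x sigma lam).

Lemma model_error_le k : viji_reached L rho T v x k ->
  enorm (F (x k) - F (v k) - J k *m (x k - v k)) <= a k * r k.
Proof.
move=> kr; have [Zv _] := viji_argmax run kr; have Zx := viji_point run kr.
have -> : F (x k) - F (v k) - J k *m (x k - v k) =
    (F (x k) - F (v k) - dF (v k) *m (x k - v k)) +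
    (dF (v k) - J k) *m (x k - v k).
  by rewrite mulmxBl addrA subrK.
apply: (le_trans (enormD _ _)); rewrite /a mulrDl -mulrA -expr2.
apply: lerD.
  exact: (first_order_remainder_le (ltW L0) cvxZ diff lip Zx Zv).
apply: (le_trans (enorm_mulmx_le _ _)); rewrite ler_wpM2r//; exact: J_le.
Qed.

Lemma subproblem_le k z : viji_reached L rho T v x k -> Z z ->
  dot (viji_model F L delta (v k) (J k) (x k)) (x k - z) <=
    L / 2 * r k ^+ 3 + delta * r k ^+ 2.
Proof.
move=> kr Zz; apply: le_trans (viji_inexact run kr); exact: dot_le_sup.
Qed.

(** Unfolding [sigma n = - \sum_(k < n) lam k *: F (x k)] shows that, up to a
    constant, the regret against [u] minus [|u - z0|^2 / 2] is the function
    that [v n] maximises. *)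
Lemma regretE n u : (n <= N)%N ->
  \sum_(k < n) lam k * dot (F (x k)) (x k - u) =
  dot (sigma n) (u - z0) + \sum_(k < n) lam k * dot (F (x k)) (x k - z0).
Proof.
elim: n => [|n IHn] nN.
  by rewrite !big_ord0 (viji_sigma0 run) dot0l addr0.
rewrite !big_ord_recr/= (IHn (ltnW nN)) (viji_dual run nN) !dotE; ring.
Qed.

(** Since [u] is arbitrary, the induction hypothesis can be used at [v n], which
    maximises regret minus [|u - z0|^2 / 2] ([regretE]); the quadratic growth
    away from [v n] pays for the [|u - v n|^2 / 2] in [dual_step_decrease]. *)
Lemma regret_le n u : (n <= N)%N -> Z u ->
  \sum_(k < n) lam k * dot (F (x k)) (x k - u) <=
  2^-1 * enorm (u - z0) ^+ 2 - 8^-1 * \sum_(k < n) r k ^+ 2.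
Proof.
elim: n u => [|n IHn] u nN Zu.
  by rewrite !big_ord0 mulr0 subr0 mulr_ge0 ?sqr_ge0.
have nr : viji_reached L rho T v x n := lt_length_reached nN.
have vmax := viji_argmax run nr.
have := IHn (v n) (ltnW nN) (proj1 vmax).
have := argmax_quadratic_growth cvxZ vmax Zu.
have := dual_step_decrease (viji_lam_gt0 run nN) (viji_lam_bounds run nN)
          (model_error_le nr) (subproblem_le nr Zu).
rewrite !big_ord_recr/= (regretE u (ltnW nN)) (regretE (v n) (ltnW nN)).
rewrite -/(r n); lra.
Qed.

(** A zero bracket means [x N = v N], where the model is exact and the tolerance
    of the subproblem is zero. *)
Lemma early_stop_gap_le0 z : (N < T)%N -> Z z -> dot (F z) (x N - z) <= 0.
Proof.
move=> NT Zz.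
have Nr : viji_reached L rho T v x N by rewrite /viji_reached NT leqnn.
have Lr0 : 0 <= L / 2 * r N by rewrite mulr_ge0 ?divr_ge0 ?(ltW L0) ?enorm_ge0.
have /eqP := bracket_length_eq0 NT.
rewrite /viji_bracket -/N -/(r N) paddr_eq0// => /andP[+ _].
rewrite mulf_eq0 gt_eqF ?divr_gt0//= => /eqP rN0.
have xv := enorm_eq0 rN0.
have := subproblem_le Nr Zz.
rewrite /viji_model xv mulmx0 scaler0 !addr0 rN0 !expr0n !mulr0 addr0.
have -> : v N = x N by apply/esym/subr0_eq.
apply: le_trans; rewrite -subr_ge0 -dotNl -dotDl.
exact: (mono (viji_point run Nr) Zz).
Qed.

(** Small displacements [r k] make the [a k] small, hence the dual steps [lam k],
    which are at least [1 / (32 * a k)], long.  Cauchy-Schwarz turns the bound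
    on [\sum_k r k ^+ 2] into one on [\sum_k a k], and that one into a lower
    bound on [Lam]. *)
Lemma full_run_gap_le z : (0 < T)%N -> N = T -> Z z ->
  dot (F z) ((\sum_(k < T) lam k)^-1 *: \sum_(k < T) lam k *: x k - z) <=
  16 * L * diam Z ^+ 3 / (T%:R * Num.sqrt T%:R)
    + 16 * delta * diam Z ^+ 2 / T%:R.
Proof.
move=> T0 NT Zz.
set D := diam Z; set Lam := \sum_(k < T) lam k; set t : R := T%:R.
have t0 : 0 < t by rewrite ltr0n.
have st0 : 0 < Num.sqrt t by rewrite sqrtr_gt0.
have stE : Num.sqrt t ^+ 2 = t by rewrite sqr_sqrtr ?ltW.
have lam_gt0 (k : 'I_T) : 0 < lam k.
  by apply: (viji_lam_gt0 run); rewrite -/N NT.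
have lam_bd (k : 'I_T) : 32^-1 <= lam k * a k.
  have := viji_lam_bounds run (k := k).
  by rewrite -/N NT ltn_ord => /(_ isT)/andP[].
have a_ge0 (k : 'I_T) : 0 <= a k.
  by rewrite addr_ge0// mulr_ge0 ?divr_ge0 ?(ltW L0) ?enorm_ge0.
have Lam0 : 0 < Lam.
  rewrite /Lam; case: (T) T0 lam_gt0 => // n _ lam0.
  by rewrite big_ord_recl ltr_pwDl// sumr_ge0// => i _; rewrite ltW.
have D0 : 0 <= D by apply: le_trans (enorm_le_diam cptZ Zz Zz).
set q := dot (F z) _.
have bound0 : 0 <= 16 * L * D ^+ 3 / (t * Num.sqrt t) + 16 * delta * D ^+ 2 / t.
  by rewrite addr_ge0// divr_ge0 ?mulr_ge0 ?exprn_ge0 ?(ltW L0) ?(ltW t0).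
(* A nonpositive [q] is below the bound, and a positive [q] makes the right side
   of [Lamq] below positive, which bounds [\sum_k r k ^+ 2]. *)
have [q0|q0] := leP q 0; first exact: le_trans bound0.
have Lamq : Lam * q <= 2^-1 * D ^+ 2 - 8^-1 * \sum_(k < T) r k ^+ 2.
  have -> : Lam * q = \sum_(k < T) lam k * dot (F z) (x k - z).
    rewrite /q dotC -dotZl scalerBr scalerA mulfV ?gt_eqF// scale1r.
    rewrite /Lam scaler_suml -sumrB dot_suml; apply: eq_bigr => k _.
    by rewrite -scalerBr dotZl dotC.
  apply: (le_trans (y := \sum_(k < T) lam k * dot (F (x k)) (x k - z))).
    apply: ler_sum => k _; rewrite ler_wpM2l ?(ltW (lam_gt0 k))//.
    rewrite -subr_ge0 -dotNl -dotDl.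
    apply: mono => //; apply: (viji_point run); apply: lt_length_reached.
    by rewrite -/N NT.
  apply: (le_trans (regret_le _ Zz)); first by rewrite NT.
  rewrite lerD2r ler_wpM2l// lerXn2r ?nnegrE//.
  exact: (enorm_le_diam cptZ Zz (viji_start run)).
have r2_le : \sum_(k < T) r k ^+ 2 <= (2 * D) ^+ 2.
  have := mulr_gt0 Lam0 q0; lra.
have r_le : \sum_(k < T) r k <= 2 * D * Num.sqrt t.
  have r_ge0 : 0 <= \sum_(k < T) r k.
    by apply: sumr_ge0 => k _; exact: enorm_ge0.
  rewrite -ler_sqr ?nnegrE ?mulr_ge0 ?(ltW st0)//.
  rewrite exprMn stE.
  have := sum_CauchySchwarz (fun k : 'I_T => r k) (fun=> 1).
  under eq_bigr do rewrite mulr1.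
  have -> : \sum_(k < T) 1 ^+ 2 = t.
    by under eq_bigr do rewrite expr1n; rewrite sumr_const card_ord.
  by move=> /le_trans; apply; rewrite ler_wpM2r ?(ltW t0).
have A_le : \sum_(k < T) a k <= L * D * Num.sqrt t + delta * t.
  rewrite big_split/= sumr_const card_ord -[_ *+ T]mulr_natr lerD2r -mulr_sumr.
  have -> : L * D * Num.sqrt t = L / 2 * (2 * D * Num.sqrt t) by field.
  by rewrite ler_wpM2l// divr_ge0 ?ltW.
have t2_le : t ^+ 2 <= 32 * (Lam * \sum_(k < T) a k).
  have := sum_CauchySchwarz
    (fun k : 'I_T => Num.sqrt (lam k)) (fun k => Num.sqrt (a k)).
  under eq_bigr do rewrite -sqrtrM ?ltW//.
  under [X in _ <= X * _]eq_bigr do rewrite sqr_sqrtr ?ltW//.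
  under [X in _ <= _ * X]eq_bigr do rewrite sqr_sqrtr//.
  rewrite -/Lam => CS; rewrite -ler_pdivrMl//; apply: le_trans CS.
  have -> : 32^-1 * t ^+ 2 = (\sum_(k < T) Num.sqrt 32^-1) ^+ 2.
    by rewrite sumr_const card_ord -[_ *+ T]mulr_natr exprMn sqr_sqrtr.
  rewrite ler_sqr ?nnegrE ?sumr_ge0//; apply: ler_sum => k _.
  by rewrite ler_sqrt// (le_trans _ (lam_bd k)).
have q_le : q * t ^+ 2 <= 16 * D ^+ 2 * (L * D * Num.sqrt t + delta * t).
  have A0 : 0 <= \sum_(k < T) a k by rewrite sumr_ge0.
  apply: (le_trans (ler_wpM2l (ltW q0) t2_le)).
  apply: (le_trans (y := 16 * D ^+ 2 * \sum_(k < T) a k)); last first.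
    by rewrite ler_wpM2l// mulr_ge0 ?sqr_ge0.
  have r20 : 0 <= \sum_(k < T) r k ^+ 2.
    by apply: sumr_ge0 => k _; exact: sqr_ge0.
  have -> : q * (32 * (Lam * \sum_(k < T) a k)) =
    32 * (Lam * q) * \sum_(k < T) a k by ring.
  rewrite ler_wpM2r//; lra.
move: q_le; rewrite -ler_pdivlMr ?exprn_gt0// => /le_trans; apply.
rewrite le_eqVlt; apply/orP; left; apply/eqP.
have rateE (y : R) : 0 < y ->
    16 * D ^+ 2 * (L * D * y + delta * y ^+ 2) / (y ^+ 2) ^+ 2 =
    16 * L * D ^+ 3 / (y ^+ 2 * y) + 16 * delta * D ^+ 2 / y ^+ 2.
  by move=> y0; field; rewrite gt_eqF.
by have := rateE _ st0; rewrite stE.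
Qed.

End Run.
End Viji.

Theorem corollary1 (R : realType) (d M T : nat) (Z : set 'cV[R]_d)
    (w : 'I_M.+1 -> R) (Fi : 'I_M.+1 -> 'cV[R]_d -> 'cV[R]_d)
    (dFi : 'I_M.+1 -> 'cV[R]_d -> 'M[R]_d) (L1 : R)
    (z0 : 'cV[R]_d) (v x sigma : nat -> 'cV[R]_d) (lam : nat -> R) :
  let F := fun z => \sum_(i < M.+1) w i *: Fi i z in
  let dF := fun z => \sum_(i < M.+1) w i *: dFi i z in
  let D := diam Z in
  let beta := sup [set opnorm (dF z - dFi ord0 z) | z in Z] in
  let J := fun k : nat => dFi ord0 (v k) in
  let rho := fun _ : nat => beta in
  Z !=set0 -> compact Z -> convex_set Z ->
  (forall i, 0 < w i) -> \sum_(i < M.+1) w i = 1 ->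
  (forall i, C1_on Z (Fi i) (dFi i)) ->
  monotone_on Z F ->
  0 < L1 -> op_lipschitz_on Z dF L1 ->
  (1 <= T)%N ->
  viji_run Z F L1 beta J rho T z0 v x sigma lam ->
  (forall k, viji_reached L1 rho T v x k -> opnorm (dF (v k) - J k) <= beta) /\
  gap Z F (viji_output L1 rho T v x lam)
    <= 16 * Num.sqrt 2 * L1 * D ^+ 3 / (T%:R `^ (3 / 2))
       + 16 * Num.sqrt 2 * beta * D ^+ 2 / T%:R.
Proof.
move=> F dF D beta J rho Z0 cptZ cvxZ w_gt0 w1 C1 mono L0 lip T0 run.
have w_ge0 i : 0 <= w i by rewrite ltW.
have cdiff : {within Z, continuous (fun z => dF z - dFi ord0 z)}.
  apply: within_continuousB; last by case: (C1 ord0).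
  by apply: within_continuous_sum => i; case: (C1 i).
have opnorm_le z : Z z -> opnorm (dF z - dFi ord0 z) <= beta.
  move=> Zz; exact: (opnorm_le_sup cptZ cdiff).
have beta0 : 0 <= beta.
  by case: Z0 => z Zz; apply: le_trans (opnorm_le z Zz); exact: opnorm_ge0.
have J_le k : viji_reached L1 rho T v x k -> opnorm (dF (v k) - J k) <= beta.
  by move=> /(viji_argmax run)[Zv _]; exact: opnorm_le.
split=> //.
have diffF : has_jacobian_on Z F dF.
  by apply: has_jacobian_on_sum => // i; case: (C1 i).
have D0 : 0 <= D.
  by case: Z0 => z Zz; apply: le_trans (enorm_le_diam cptZ Zz Zz).
have sqrt2 : 1 <= Num.sqrt 2 :> R by rewrite -[leLHS]sqrtr1 ler_sqrt// ler1n.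
have powE : T%:R `^ (3 / 2) = T%:R * Num.sqrt T%:R :> R.
  rewrite (_ : 3 / 2 = 1 + 2^-1); last by field.
  by rewrite powRD ?powRr1 ?powR12_sqrt// pnatr_eq0 -lt0n T0 implybT.
have bound : 16 * L1 * D ^+ 3 / (T%:R * Num.sqrt T%:R)
      + 16 * beta * D ^+ 2 / T%:R <=
    16 * Num.sqrt 2 * L1 * D ^+ 3 / (T%:R `^ (3 / 2))
      + 16 * Num.sqrt 2 * beta * D ^+ 2 / T%:R.
  by rewrite powE; apply: lerD; rewrite ler_wpM2r ?invr_ge0 ?mulr_ge0//;
    rewrite ler_wpM2r ?exprn_ge0// -!mulrA ler_wpM2l// ler_peMl// (ltW L0).
apply: ge_sup => [|_ [z Zz <-]]; first exact: image_nonempty.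
rewrite /viji_output; case: ltnP => [NT|TN].
  apply: le_trans bound.
  apply: (le_trans (early_stop_gap_le0 cptZ L0 beta0 mono run NT Zz)).
  by rewrite addr_ge0// divr_ge0 ?mulr_ge0 ?exprn_ge0 ?(ltW L0).
apply: le_trans bound.
have NT : viji_length L1 rho T v x = T.
  by apply/eqP; rewrite eqn_leq viji_length_le.
exact: (full_run_gap_le cptZ cvxZ L0 beta0 mono lip diffF J_le run).
Qed.
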